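(* Let $\Sigma$ be an alphabet, let $\le_\alpha$ be any partial order on $\Sigma^*$, and let $k\in\mathbb{N}_0$. Then the following hold. 1. The class $\mathbb{P}_{k\text{-}\alpha}$ of $k$-$\alpha$ languages is a $(k+3)$-independent property; hence, every $k$-$\alpha$ language is included in a $\mathbb{P}_{k\text{-}\alpha}$-maximal language. 2. If $\le_\alpha$ is a right-infinite order then, for every finitely-$\alpha$ language $L$, there is a word $z\in\Sigma^*$ with $z\notin L$ such that $L\cup\{z\}$ is a finitely-$\alpha$ language. Hence, the class $\mathbb{P}_{\mathrm{fin}\text{-}\alpha}$ of finitely-$\alpha$ languages is not a Jürgensen property.
   Context: $\mathbb{N}$ is the set of positive integers and $\mathbb{N}_0$ the set of non-negative integers. Languages are subsets of $\Sigma^*$, where $\Sigma$ is an alphabet (a finite nonempty set of symbols); words are elements of $\Sigma^*$. A language property is a class (set) of languages. For a partial order $\le_\alpha$ on $\Sigma^*$, $<_\alpha$ denotes its strict version: $u<_\alpha v$ iff $u\le_\alpha v$ and $u\ne v$. - $\mathbb{P}_{k\text{-}\alpha}$, the class of $k$-$\alpha$ languages: $L\in\mathbb{P}_{k\text{-}\alpha}$ iff for every $w\in L$ there are at most $k$ words $v\in L$ with $w<_\alpha v$. - $\mathbb{P}_{\mathrm{fin}\text{-}\alpha}$, the class of finitely-$\alpha$ languages: $L\in\mathbb{P}_{\mathrm{fin}\text{-}\alpha}$ iff for every $w\in L$ the set $\{v\in L : w<_\alpha v\}$ is finite. - The order $\le_\alpha$ is right-infinite if for every word $u$ there is a word $v$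 such that $u<_\alpha v$. - For $n\in\mathbb{N}\cup\{\aleph_0\}$, an $n$-independent property is a class of languages $\mathbb{P}$ such that for every language $L$: $L\in\mathbb{P}$ if and only if $L'\in\mathbb{P}$ for all $L'\subseteq L$ with $|L'|<n$. - A Jürgensen property is a class of languages that is an $n$-independent property for some $n\in\mathbb{N}\cup\{\aleph_0\}$. - For a class $\mathbb{P}$ of languages, a $\mathbb{P}$-maximal language is a language $M\in\mathbb{P}$ such that $M\cup\{w\}\notin\mathbb{P}$ for all words $w\notin M$. *)

(* Defs.v *)
From mathcomp Require Import all_boot.
From mathcomp Require Import boolp classical_sets functions cardinality.
From Stdlib Require Relation_Definitions.

Set Implicit Arguments.
Unset Strict Implicit.
Unset Printing Implicit Defensive.

Local Open Scope classical_set_scope.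
Local Open Scope card_scope.

(* The finite type Sigma is an arbitrary finite set of symbols; that it is
   nonempty has to be assumed separately.                                     *)
Definition word (Sigma : finType) := seq Sigma.
Definition language (Sigma : finType) := set (word Sigma).
Definition property (Sigma : finType) := set (language Sigma).

Definition partial_order (T : Type) (le : T -> T -> Prop) : Prop :=
  Relation_Definitions.order T le.

Definition strict (T : Type) (le : T -> T -> Prop) (u v : T) : Prop :=
  le u v /\ u <> v.

Definition above (Sigma : finType) (le : word Sigma -> word Sigma -> Prop)
    (L : language Sigma) (w : word Sigma) : language Sigma :=
  [set v | L v /\ strict le w v].

(* `I_k is the set {0, ..., k-1}, so A #<= `I_k says that A has at most k
   elements.                                                                  *)
Definition k_languages (Sigma : finType)
    (le : word Sigma -> word Sigma -> Prop) (k : nat) : property Sigma :=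
  [set L | forall w, L w -> above le L w #<= `I_k].

Definition fin_languages (Sigma : finType)
    (le : word Sigma -> word Sigma -> Prop) : property Sigma :=
  [set L | forall w, L w -> finite_set (above le L w)].

Definition right_infinite (T : Type) (le : T -> T -> Prop) : Prop :=
  forall u, exists v, strict le u v.

(* Cardinals that are natural numbers or aleph_0. *)
Inductive cardinal : Type := NatCard of nat | Aleph0.

Definition card_lt (T : Type) (A : set T) (n : cardinal) : Prop :=
  match n with
  | NatCard m => exists2 i : nat, (i < m)%N & A #= `I_i
  | Aleph0 => finite_set A
  end.

Definition cardinal_pos (n : cardinal) : Prop :=
  match n with
  | NatCard m => (0 < m)%N
  | Aleph0 => True
  end.

Definition independent (Sigma : finType) (n : cardinal) (P : property Sigma) :
    Prop :=
  cardinal_pos n /\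
  forall L : language Sigma,
    P L <-> (forall L' : language Sigma, L' `<=` L -> card_lt L' n -> P L').

Definition jurgensen (Sigma : finType) (P : property Sigma) : Prop :=
  exists n : cardinal, independent n P.

Definition maximal_language (Sigma : finType) (P : property Sigma)
    (M : language Sigma) : Prop :=
  P M /\ (forall w, ~ M w -> ~ P (M `|` [set w])).

(* Main.v *)
(* A maximal extension exists for every n-independent property by Zorn's lemma:
   a finite subset of the union of a chain already lies in a member of the
   chain.  For the second part, a nonempty finitely-alpha language has a maximal
   word m, and by right-infinity some z lies strictly above m; such a z is not
   in L, and no word of L lies above z.  If the finitely-alpha languages were
   n-independent, the set of all words, whose finite subsets are trivially
   finitely-alpha, would be finitely-alpha, yet it admits no new word z. *)

Require Import Defs.
From mathcomp Require Import all_boot.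
From mathcomp Require Import boolp classical_sets functions cardinality.

Local Open Scope classical_set_scope.
Local Open Scope card_scope.

Lemma card_lt_finite (T : Type) (A : set T) (n : cardinal) :
  card_lt A n -> finite_set A.
Proof. by case: n => [m [i _ Ai]|//]; apply/finite_setP; exists i. Qed.

(** Induction on a list of the elements of [A]: the member containing the tail and the one
    containing the head are comparable, and the larger contains both. *)
Lemma finite_sub_bigcup_chain (T : choiceType) (F : set (set T)) (A : set T) :
  F !=set0 -> total_on F subset -> finite_set A -> A `<=` \bigcup_(X in F) X ->
  exists2 X, F X & A `<=` X.
Proof.
move=> [X0 FX0] Ftot /finite_seqP[s ->].
elim: s => [|a s IHs] sF; first by exists X0.
have [|X FX sX] := IHs.
  by move=> x /= xs; apply: sF; rewrite /= inE xs orbT.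
have [|Y FY Ya] := sF a; first by rewrite /= inE eqxx.
have [XY|YX] := Ftot _ _ FX FY; [exists Y|exists X] => // x /=;
  rewrite inE => /orP[/eqP->|/sX] //; [exact: XY|exact: YX].
Qed.

Lemma independent_maximal_extension (Sigma : finType) (n : cardinal)
    (P : property Sigma) (L : language Sigma) :
  independent n P -> P L ->
  exists M : language Sigma, L `<=` M /\ maximal_language P M.
Proof.
move=> [_ Pn] PL.
(* Zorn is applied to the added sets [A] rather than to the extensions of [L], so that the empty
   chain, with empty union, is covered by [P L]. *)
have [F FP Ftot|A [PA Amax]] :=
    @Zorn_bigcup (word Sigma) [set A | P (L `|` A)].
  apply/Pn => L' L'sub L'n.
  (* Adjoining [L] itself keeps the chain nonempty even when [F] is empty. *)
  pose G := [set L] `|` [set L `|` A | A in F].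
  have GP X : G X -> P X by move=> [->//|[A FA <-]]; exact: FP.
  have Gtot : total_on G subset.
    move=> _ _ [->|[A FA <-]] [->|[B FB <-]].
    - by left.
    - by left; exact: subsetUl.
    - by right; exact: subsetUl.
    - by have [AB|BA] := Ftot _ _ FA FB; [left|right]; exact: setUS.
  have [||X GX L'X] := @finite_sub_bigcup_chain _ G L' _ Gtot
      (card_lt_finite _ _ _ L'n).
  - by exists L; left.
  - move=> x /L'sub[Lx|[A FA Ax]]; first by exists L; [left|].
    by exists (L `|` A); [right; exists A|right].
  - by move/GP/Pn: GX; exact.
exists (L `|` A); split; first exact: subsetUl.
split=> // w nLAw; rewrite -setUA; apply: Amax.
split; first exact: subsetUl.
by move=> /(_ w (or_intror erefl)) Aw; apply: nLAw; right.
Qed.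

Lemma card_le_II_dichotomy (T : Type) (A : set T) (k : nat) :
  A #<= `I_k \/ exists2 B, B `<=` A & B #= `I_k.+1.
Proof.
elim/Ppointed: T => T in A *; first by left; exact: card_le_emptyl.
suff [?|/ppcard_leP[f]] : A #<= `I_k \/ `I_k.+1 #<= A; [by left| |].
  right; exists (f @` `I_k.+1); first by move=> _ [i ik <-]; exact: funS.
  exact: card_image.
have [/finite_setP[n An]|/infiniteP Ainf] := pselect (finite_set A); last first.
  by right; apply: card_le_trans Ainf; exact: card_leT.
rewrite (card_le_eql An) (card_le_eqr An) !card_le_II.
by have [|] := leqP n k; [left|right].
Qed.

Section Languages.
Variables (Sigma : finType) (le : word Sigma -> word Sigma -> Prop).
Implicit Types L : language Sigma.

Lemma above_subset L L' w : L' `<=` L -> above le L' w `<=` above le L w.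
Proof. by move=> L'L v [/L'L]. Qed.

Lemma k_languages_independent (k : nat) :
  independent (NatCard (k + 3)) (k_languages le k).
Proof.
split=> [|L]; first by rewrite /= addn3.
split=> [Lk L' L'L _ w /L'L/Lk|Lk w Lw].
  by apply: card_le_trans; apply: subset_card_le; exact: above_subset.
(* A violation at [w] is witnessed by [w] and [k + 1] words above it: [k + 2] words in all, hence
   the bound [k + 3]. *)
have [//|[B Babove Bk]] := card_le_II_dichotomy _ (above le L w) k.
have nBw : ~ B w by move=> /Babove[_ []].
have wBL : w |` B `<=` L by move=> v [->//|/Babove[]].
have /(_ w (or_introl erefl)) : k_languages le k (w |` B).
  apply: Lk wBL _; exists k.+2; first by rewrite addn3.
  by apply/eq_cardSP; exists w; [left|rewrite setUC setUDK//= => _ [->]].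
have : B `<=` above le (w |` B) w.
  by move=> v Bv; split; [right|have [] := Babove v Bv].
move=> /subset_card_le/card_le_trans h /h.
by rewrite (card_le_eql Bk) card_le_II ltnn.
Qed.

Lemma finite_fin_language L : finite_set L -> fin_languages le L.
Proof. by move=> Lfin w _; apply: sub_finite_set Lfin => v []. Qed.

(** Adjoining [z] enlarges each set of words above a given word by at most [z]. *)
Lemma fin_languages_setU1 L z :
  fin_languages le L -> finite_set (above le L z) ->
  fin_languages le (L `|` [set z]).
Proof.
move=> Lfin zfin w Lzw.
apply: (@sub_finite_set _ _ (above le L w `|` [set z])).
  by move=> v [[Lv|->] wv]; [left|right].
by rewrite finite_setU; split=> //; case: Lzw => [/Lfin|->].
Qed.

Hypothesis hle : partial_order le.

Lemma finite_above_maximal L w : L w -> finite_set (above le L w) ->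
  exists2 m, L m & forall v, L v -> ~ strict le m v.
Proof.
case: hle => lexx le_trans le_anti Lw /finite_seqP[s Ls].
(* Scan [s] from its end, starting with [w] and replacing the current candidate [m] by each [a] with
   [le m a]. *)
have [m wm mP] : exists2 m, w = m \/ above le L w m &
    forall v, v \in s -> le m v -> v = m.
  have : [set` s] `<=` above le L w by rewrite Ls.
  elim: {Ls} s => [|a s IHs] sL; first by exists w; [left|].
  have [|m wm mP] := IHs.
    by move=> v /= vs; apply: sL; rewrite /= inE vs orbT.
  have [ma|nma] := pselect (le m a); last first.
    by exists m => // v; rewrite inE => /orP[/eqP-> /nma|/mP].
  exists a; first by right; apply: sL; rewrite /= inE eqxx.
  move=> v; rewrite inE => /orP[/eqP//|vs av].
  have vm := mP v vs (le_trans _ _ _ ma av).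
  by rewrite vm in av *; exact: le_anti.
have [Lm lewm] : L m /\ le w m by case: wm => [<-|[? []]].
exists m => // v Lv [mv]; apply => /=.
(* The case [w = v] is separate because [s] lists only words strictly above [w]. *)
have [wv|nwv] := pselect (w = v); first by rewrite -wv in mv *; exact: le_anti.
apply/esym/mP => //; have : above le L w v.
  by split=> //; split=> //; exact: le_trans lewm mv.
by rewrite Ls.
Qed.

Hypothesis hinf : right_infinite le.

Lemma fin_languages_extend L : fin_languages le L ->
  exists z, ~ L z /\ fin_languages le (L `|` [set z]).
Proof.
move=> Lfin; case: hle => _ le_trans le_anti.
have [->|/set0P[w Lw]] := eqVneq L set0.
  exists [::]; split=> //; apply: finite_fin_language.
  by rewrite set0U; exact: finite_set1.
have [m Lm mmax] := finite_above_maximal _ _ Lw (Lfin _ Lw).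
have [z mz] := hinf m; exists z; split=> [/mmax//|].
apply: fin_languages_setU1 => //.
suff -> : above le L z = set0 by exact: finite_set0.
rewrite -subset0 => v [/mmax mv [zv _]]; apply: mv.
(* A word [v] of [L] above [z] would be above [m] by transitivity, and [v = m] would force [z = m]
   by antisymmetry. *)
case: mz => mz nmz; split; first exact: le_trans mz zv.
by move=> mv; apply: nmz; apply: le_anti mz _; rewrite mv.
Qed.

Lemma fin_languages_not_jurgensen : ~ jurgensen (fin_languages le).
Proof.
move=> [n [_ nP]].
have /fin_languages_extend[z [+ _]] : fin_languages le setT; last by apply.
by apply/nP => L' _ /card_lt_finite/finite_fin_language.
Qed.

End Languages.

Theorem theorem1 (Sigma : finType) (hSigma : (0 < #|Sigma|)%N)
    (le : word Sigma -> word Sigma -> Prop) (hle : partial_order le)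
    (k : nat) :
  (independent (NatCard (k + 3)%N) (k_languages le k) /\
   (forall L : language Sigma, k_languages le k L ->
      exists M : language Sigma,
        L `<=` M /\ maximal_language (k_languages le k) M)) /\
  (right_infinite le ->
   (forall L : language Sigma, fin_languages le L ->
      exists z : word Sigma, ~ L z /\ fin_languages le (L `|` [set z])) /\
   ~ jurgensen (fin_languages le)).
Proof.
have kP := k_languages_independent _ le k.
split; first by split=> // L; exact: independent_maximal_extension kP.
move=> hinf; split; first exact: fin_languages_extend.
exact: fin_languages_not_jurgensen.
Qed.
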